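(* Consider the droop-controlled islanded microgrid $\dot x=f(x,t)$ described in the context, defined on a convex admissible domain $\mathcal D\subseteq\mathbb R^{2N}$. Let $c_\theta>0$, $c_V>0$ and $\beta\ge 0$ be constants such that, for all $x\in\mathcal D$ and all $t\ge 0$, the blocks of the symmetric part $\mathcal S(x,t)$ of the projected Jacobian satisfy $$\lambda_{\max}(\mathcal S_{\theta\theta}(x,t))\le -c_\theta,\qquad \lambda_{\max}(\mathcal S_{VV}(x,t))\le -c_V,\qquad \|\mathcal S_{\theta V}(x,t)\|_2\le\beta .$$ If $c_\theta c_V>\beta^2$, then the system is semi-contracting on $\mathcal D$ with respect to the seminorm $\|\cdot\|_R$; specifically, $$\mu_R(J(x,t))\le -c\qquad\text{for all }x\in\mathcal D,\ t\ge 0,$$ where $$c:=\tfrac12\Big(c_\theta+c_V-\sqrt{(c_\theta-c_V)^2+4\beta^2}\Big)>0 .$$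
   Context: Microgrid model. $N\ge 2$ buses $\mathcal V=\{1,\dots,N\}$ form a graph with edge set $\mathcal E$; $Y=G+jB\in\mathbb C^{N\times N}$ is the (symmetric) network admittance matrix with $G,B$ real and $Y_{ik}=0$ if $i\ne k$ and $(i,k)\notin\mathcal E$. The state is $x=[\theta^\top,V^\top]^\top\in\mathbb R^{2N}$ (phase angles $\theta_i$, voltage magnitudes $V_i$). With $\theta_{ik}:=\theta_i-\theta_k$, $$P_i=V_i^2G_{ii}+V_i\sum_{k\ne i}V_k(G_{ik}\cos\theta_{ik}+B_{ik}\sin\theta_{ik}),$$ $$Q_i=-V_i^2B_{ii}+V_i\sum_{k\ne i}V_k(G_{ik}\sin\theta_{ik}-B_{ik}\cos\theta_{ik}).$$ The dynamics $\dot x=f(x,t)$ are $$\dot\theta_i=\omega_{\mathrm{nom}}-m_{p,i}(P_i-P_i^{\mathrm{ref}}(t)),\qquad \tau_{v,i}\dot V_i=V_{\mathrm{nom},i}-V_i-n_{q,i}(Q_i-Q_i^{\mathrm{ref}}(t)),$$ with real constants $\omega_{\mathrm{nom}},V_{\mathrm{nom},i}$, $m_{p,i}>0$, $n_{q,i}\ge0$, $\tau_{v,i}>0$, and references $P_i^{\mathrm{ref}}(t)=P_{i,0}^{\mathrm{ref}}+p_i(t)$, $Q_i^{\mathrm{ref}}(t)=Q_{i,0}^{\mathrm{ref}}+q_i(t)$ that are given functions of $t\ge0$. Projection and seminorm. $R_\theta\in\mathbb R^{(N-1)\times N}$ has orthonormal rows spanning $\mathrm{span}\{\mathbf 1_N\}^\perp$;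 $R:=\mathrm{blkdiag}(R_\theta,I_N)\in\mathbb R^{(2N-1)\times 2N}$; $\|x\|_R:=\|Rx\|_2$, a seminorm with kernel $\ker(R)=\mathrm{span}\{[\mathbf 1_N^\top,\mathbf 0_N^\top]^\top\}$. Admissible domain. $\mathcal D$ is a compact set of states such that $V_i\in[\underline V,\overline V]$ for all $i$ (with $0<\underline V\le\overline V$) and $|\theta_{ik}|\le\gamma_{\max}<\pi/2$ for all $(i,k)\in\mathcal E$. Jacobian blocks. $J(x,t):=D_xf(x,t)$ (independent of $t$, since the references enter additively), partitioned as $J=\begin{bmatrix} J_{\theta\theta} & J_{\theta V} \\ J_{V\theta} & J_{VV} \end{bmatrix}$. The projected Jacobian is $J_R:=RJR^\top$, and $\mathcal S:=\frac12(J_R+J_R^\top)=\begin{bmatrix} \mathcal S_{\theta\theta} & \mathcal S_{\theta V} \\ \mathcal S_{\theta V}^\top & \mathcal S_{VV} \end{bmatrix}$ with diagonal blocks of sizes $N-1$ and $N$. Matrix measure. For $A\in\mathbb R^{2N\times 2N}$, $\|A\|_R:=\max\{\|Az\|_R:\ z\perp\ker(R),\ \|z\|_R=1\}$ and $\mu_R(A):=\lim_{h\to0^+}\frac{\|I+hA\|_R-1}{h}$; one has $\mu_R(A)=\mu_2(RAR^\top)=\lambda_{\max}\big(\tfrac12(RAR^\top+RA^\top R^\top)\big)$. The system is semi-contracting on the convex set $\mathcal D$ with rate $c>0$ with respect to $\|\cdot\|_R$ if $\mu_R(D_xf(x,t))\le -c$ for all $x\in\mathcal D$, $t\ge0$.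 *)

(* Defs.v *)
From mathcomp Require Import all_boot all_order all_algebra.
From mathcomp Require Import complex.
From mathcomp Require Import all_classical all_reals all_analysis.

Set Implicit Arguments.
Unset Strict Implicit.
Unset Printing Implicit Defensive.

Import Order.TTheory GRing.Theory Num.Theory.
Import numFieldNormedType.Exports.
Local Open Scope classical_set_scope.
Local Open Scope ring_scope.

(* States are row vectors [row_mx theta V], the format of the library's
   [jacobian]; every other vector (in seminorms, operator norms, kernels) is a
   column vector. *)

Section LinearAlgebra.
Context {R : realType}.

Definition norm2 n (v : 'cV[R]_n) : R := Num.sqrt (\sum_i v i 0 ^+ 2).

(* For [0 < n] the unit sphere is nonempty and compact, so this [sup] is a
   maximum. *)
Definition opnorm2 m n (A : 'M[R]_(m, n)) : R :=
  sup [set norm2 (A *m v) | v in [set v : 'cV[R]_n | norm2 v = 1]].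

(* Only used on symmetric matrices of positive size: the set is then nonempty
   and finite, so this [sup] is a maximum. *)
Definition lambda_max n (A : 'M[R]_n) : R := sup [set a : R | eigenvalue A a].

Definition sympart n (A : 'M[R]_n) : 'M[R]_n := 2^-1 *: (A + A^T).

Definition seminorm p n (W : 'M[R]_(p, n)) (x : 'cV[R]_n) : R :=
  norm2 (W *m x).

Definition perp_ker p n (W : 'M[R]_(p, n)) (z : 'cV[R]_n) : Prop :=
  forall w : 'cV[R]_n, W *m w = 0 -> w^T *m z = 0.

(* For [W != 0] the constraint set is nonempty and compact, so this [sup] is a
   maximum. *)
Definition opseminorm p n (W : 'M[R]_(p, n)) (A : 'M[R]_n) : R :=
  sup [set seminorm W (A *m z) |
       z in [set z : 'cV[R]_n | perp_ker W z /\ seminorm W z = 1]].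

(* If the limit did not exist, [lim] would return 0; a strictly negative bound
   on [mxmeasure W A] therefore entails its existence. *)
Definition mxmeasure p n (W : 'M[R]_(p, n)) (A : 'M[R]_n) : R :=
  lim ((opseminorm W (1%:M + h *: A) - 1) / h @[h --> 0^'+]).

End LinearAlgebra.

Record microgrid (R : realType) (N : nat) := Microgrid {
  edge : rel 'I_N;
  edge_sym : symmetric edge;
  edge_irr : irreflexive edge;
  admittance : 'M[R[i]]_N;
  admittance_sym : admittance^T = admittance;
  admittance_edge : forall i k : 'I_N,
    i != k -> ~~ edge i k -> admittance i k = 0;
  omega_nom : R;
  V_nom : 'I_N -> R;
  m_p : 'I_N -> R;
  n_q : 'I_N -> R;
  tau_v : 'I_N -> R;
  m_p_gt0 : forall i, 0 < m_p i;
  n_q_ge0 : forall i, 0 <= n_q i;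
  tau_v_gt0 : forall i, 0 < tau_v i;
  P_ref0 : 'I_N -> R;
  Q_ref0 : 'I_N -> R;
  (* only their values at times [0 <= t] matter *)
  p_ref : 'I_N -> R -> R;
  q_ref : 'I_N -> R -> R
}.

Section Model.
Context {R : realType} {N : nat}.
Implicit Types (mg : microgrid R N) (x : 'rV[R]_(N + N)) (t : R).

Definition theta x (i : 'I_N) : R := lsubmx x 0 i.
Definition Vmag x (i : 'I_N) : R := rsubmx x 0 i.

Definition conductance mg : 'M[R]_N := map_mx (@complex.Re R) (admittance mg).
Definition susceptance mg : 'M[R]_N := map_mx (@complex.Im R) (admittance mg).

Definition P_inj mg x (i : 'I_N) : R :=
  let G := conductance mg in let B := susceptance mg in
  Vmag x i ^+ 2 * G i i +
  Vmag x i * \sum_(k < N | k != i) Vmag x k *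
    (G i k * cos (theta x i - theta x k) + B i k * sin (theta x i - theta x k)).

Definition Q_inj mg x (i : 'I_N) : R :=
  let G := conductance mg in let B := susceptance mg in
  - (Vmag x i ^+ 2 * B i i) +
  Vmag x i * \sum_(k < N | k != i) Vmag x k *
    (G i k * sin (theta x i - theta x k) - B i k * cos (theta x i - theta x k)).

Definition P_ref mg (i : 'I_N) t : R := P_ref0 mg i + p_ref mg i t.
Definition Q_ref mg (i : 'I_N) t : R := Q_ref0 mg i + q_ref mg i t.

Definition field mg t x : 'rV[R]_(N + N) :=
  row_mx
    (\row_i (omega_nom mg - m_p mg i * (P_inj mg x i - P_ref mg i t)))
    (\row_i ((V_nom mg i - Vmag x i - n_q mg i * (Q_inj mg x i - Q_ref mg i t))
             / tau_v mg i)).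

(* The library's [jacobian] acts on row vectors from the right, hence the
   transpose: [Jac f t x i j] is the derivative of component [i] of [f t] along
   coordinate [j]. *)
Definition Jac (f : R -> 'rV[R]_(N + N) -> 'rV[R]_(N + N)) t x
    : 'M[R]_(N + N) :=
  (jacobian (f t) x)^T.

Definition orthonormal_basis_perp1 (Rtheta : 'M[R]_(N.-1, N)) : Prop :=
  Rtheta *m Rtheta^T = 1%:M /\
  forall v : 'rV[R]_N, (v <= Rtheta)%MS = (\sum_j v 0 j == 0).

Definition Rproj (Rtheta : 'M[R]_(N.-1, N)) : 'M[R]_(N.-1 + N, N + N) :=
  block_mx Rtheta 0 0 1%:M.

Definition Sproj (Rtheta : 'M[R]_(N.-1, N)) (J : 'M[R]_(N + N))
    : 'M[R]_(N.-1 + N) :=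
  sympart (Rproj Rtheta *m J *m (Rproj Rtheta)^T).

Definition admissible_domain mg (Vlow Vupp gamma_max : R)
    (D : set 'rV[R]_(N + N)) : Prop :=
  [/\ 0 < Vlow <= Vupp, gamma_max < pi / 2, compact D &
      forall x, D x ->
        (forall i, Vlow <= Vmag x i <= Vupp) /\
        (forall i k, edge mg i k -> `|theta x i - theta x k| <= gamma_max)].

Definition semi_contracting p (W : 'M[R]_(p, N + N))
    (f : R -> 'rV[R]_(N + N) -> 'rV[R]_(N + N)) (D : set 'rV[R]_(N + N))
    (c : R) : Prop :=
  0 < c /\
  forall x t, D x -> 0 <= t -> mxmeasure W (Jac f t x) <= - c.

End Model.

(* Main.v *)
(* Since the rows of W are orthonormal, z is orthogonal to ker W iff
   z = W^T y with y = W z, so the induced seminorm of 1 + hJ is the spectral norm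
   of 1 + hA with A = W J W^T.  The difference quotients of the latter converge
   to the supremum of y^T A y over the unit sphere, because
   1 + h y^T A y <= |y + h A y| <= 1 + h y^T A y + h^2 |A y|^2 / 2.
   Only the symmetric part of A enters y^T A y; splitting y = (u, v), it is at
   most - c_theta |u|^2 + 2 beta |u| |v| - c_V |v|^2, and -c is the largest
   eigenvalue of this 2 x 2 form. *)

Require Import Defs.
From mathcomp Require Import all_boot all_order all_algebra ring lra.
From mathcomp Require Import all_classical all_reals all_analysis.

Import Order.TTheory GRing.Theory Num.Theory.
Import numFieldNormedType.Exports.
Local Open Scope classical_set_scope.
Local Open Scope ring_scope.

Section Euclid.
Local Set Implicit Arguments.
Local Unset Strict Implicit.
Context {R : realType}.

(** * Euclidean inner product and norm on column vectors *)

Definition dot n (u v : 'cV[R]_n) : R := \sum_i u i 0 * v i 0.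

Lemma dotE n (u v : 'cV[R]_n) : u^T *m v = (dot u v)%:M.
Proof.
rewrite [LHS]mx11_scalar mxE; congr (_%:M).
by apply: eq_bigr => i _; rewrite mxE.
Qed.

Lemma dotC n (u v : 'cV[R]_n) : dot u v = dot v u.
Proof. by apply: eq_bigr => i _; rewrite mulrC. Qed.

Lemma dotDl n (u v w : 'cV[R]_n) : dot (u + v) w = dot u w + dot v w.
Proof. by rewrite -big_split; apply: eq_bigr => i _; rewrite !mxE mulrDl. Qed.

Lemma dotZl n a (u w : 'cV[R]_n) : dot (a *: u) w = a * dot u w.
Proof. by rewrite mulr_sumr; apply: eq_bigr => i _; rewrite !mxE mulrA. Qed.

Lemma dotDr n (u v w : 'cV[R]_n) : dot w (u + v) = dot w u + dot w v.
Proof. by rewrite dotC dotDl !(dotC w). Qed.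

Lemma dotZr n a (u w : 'cV[R]_n) : dot w (a *: u) = a * dot w u.
Proof. by rewrite dotC dotZl dotC. Qed.

Lemma dot_mull m n (A : 'M[R]_(m, n)) (u : 'cV[R]_n) (v : 'cV[R]_m) :
  dot (A *m u) v = dot u (A^T *m v).
Proof.
have : (dot (A *m u) v)%:M = (dot u (A^T *m v))%:M :> 'M[R]_1.
  by rewrite -!dotE trmx_mul mulmxA.
by move/matrixP => /(_ 0 0); rewrite !mxE.
Qed.

Lemma dot_mulr m n (A : 'M[R]_(m, n)) (u : 'cV[R]_n) (v : 'cV[R]_m) :
  dot v (A *m u) = dot (A^T *m v) u.
Proof. by rewrite dotC dot_mull dotC. Qed.

Lemma dot_col_mx m n (u1 v1 : 'cV[R]_m) (u2 v2 : 'cV[R]_n) :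
  dot (col_mx u1 u2) (col_mx v1 v2) = dot u1 v1 + dot u2 v2.
Proof.
rewrite /dot big_split_ord /=; congr (_ + _); apply: eq_bigr => i _.
  by rewrite !col_mxEu.
by rewrite !col_mxEd.
Qed.

Lemma dot_ge0 n (u : 'cV[R]_n) : 0 <= dot u u.
Proof. by apply: sumr_ge0 => i _; rewrite -expr2 sqr_ge0. Qed.

Lemma dot_eq0 n (u : 'cV[R]_n) : dot u u = 0 -> u = 0.
Proof.
move/eqP; rewrite psumr_eq0 => [/allP u0|i _]; last by rewrite -expr2 sqr_ge0.
apply/colP => i; rewrite mxE; apply/eqP.
by have := u0 i (mem_index_enum i); rewrite -expr2 sqrf_eq0.
Qed.

Lemma norm2E n (v : 'cV[R]_n) : norm2 v = Num.sqrt (dot v v).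
Proof. by []. Qed.

Lemma norm2_ge0 n (v : 'cV[R]_n) : 0 <= norm2 v.
Proof. exact: sqrtr_ge0. Qed.

Lemma sqr_norm2 n (v : 'cV[R]_n) : norm2 v ^+ 2 = dot v v.
Proof. by rewrite norm2E sqr_sqrtr // dot_ge0. Qed.

Lemma norm2_eq0 n (v : 'cV[R]_n) : norm2 v = 0 -> v = 0.
Proof. by move=> v0; apply: dot_eq0; rewrite -sqr_norm2 v0 expr0n. Qed.

Lemma norm2Z n a (v : 'cV[R]_n) : norm2 (a *: v) = `|a| * norm2 v.
Proof.
by rewrite norm2E dotZl dotZr mulrA -expr2 sqrtrM ?sqr_ge0// sqrtr_sqr.
Qed.

Lemma norm2_eq1 n (v : 'cV[R]_n) : norm2 v = 1 -> dot v v = 1.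
Proof. by move=> v1; rewrite -sqr_norm2 v1 expr1n. Qed.

Lemma norm2_normalize n (v : 'cV[R]_n) :
  norm2 v != 0 -> norm2 ((norm2 v)^-1 *: v) = 1.
Proof.
by move=> v0; rewrite norm2Z ger0_norm ?invr_ge0 ?norm2_ge0// mulVf.
Qed.

Lemma exists_unit_vector n : (0 < n)%N -> exists v : 'cV[R]_n, norm2 v = 1.
Proof.
case: n => // n _; exists (delta_mx 0 0).
rewrite norm2E /dot (bigD1 ord0)//= big1 ?addr0 ?mxE ?eqxx ?mulr1 ?sqrtr1//.
by move=> i /negPf i0; rewrite !mxE i0 mul0r.
Qed.

Lemma cauchy_schwarz n (u v : 'cV[R]_n) : dot u v <= norm2 u * norm2 v.
Proof.
have [/norm2_eq0 ->|u0] := eqVneq (norm2 u) 0.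
  by rewrite -(scale0r (0 : 'cV_n)) dotZl mul0r mulr_ge0 ?norm2_ge0.
have [/norm2_eq0 ->|v0] := eqVneq (norm2 v) 0.
  by rewrite -(scale0r (0 : 'cV_n)) dotZr mul0r mulr_ge0 ?norm2_ge0.
(* Expanding this square, with [u] and [v] scaled to equal length, gives 2 |u| |v| (|u| |v| - u.v)
   >= 0. *)
have := dot_ge0 (norm2 v *: u + (- norm2 u) *: v).
rewrite !(dotDl, dotDr, dotZl, dotZr) -!sqr_norm2 (dotC v u) => h.
have uv_gt0 : 0 < norm2 u * norm2 v.
  by rewrite mulr_gt0// lt0r ?u0 ?v0 norm2_ge0.
rewrite -subr_ge0 -(pmulr_rge0 _ uv_gt0); nra.
Qed.

(** * Bounds for the operator norm *)

Lemma norm2_mulmx_bounded m n (A : 'M[R]_(m, n)) :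
  exists2 K, 0 <= K & forall v, norm2 (A *m v) <= K * norm2 v.
Proof.
(* The witness is the Frobenius norm of [A]; Cauchy-Schwarz is applied row by row. *)
exists (Num.sqrt (\sum_i norm2 (row i A)^T ^+ 2)); first exact: sqrtr_ge0.
move=> v; rewrite norm2E -[X in _ * X]ger0_norm ?norm2_ge0//.
rewrite -sqrtr_sqr -sqrtrM; last by apply: sumr_ge0 => i _; rewrite sqr_ge0.
apply: ler_wsqrtr; rewrite mulr_suml; apply: ler_sum => i _.
have -> : (A *m v) i 0 = dot (row i A)^T v.
  by rewrite mxE; apply: eq_bigr => j _; rewrite !mxE.
rewrite -expr2 -exprMn -[X in X <= _]real_normK ?num_real//.
rewrite lerXn2r ?nnegrE ?mulr_ge0 ?norm2_ge0// ler_norml cauchy_schwarz andbT.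
rewrite lerNl -mulN1r -dotZl (le_trans (cauchy_schwarz _ _))//.
by rewrite norm2Z normrN1 mul1r.
Qed.

Lemma opnorm2_has_ubound m n (A : 'M[R]_(m, n)) :
  has_ubound [set norm2 (A *m v) | v in [set v : 'cV[R]_n | norm2 v = 1]].
Proof.
have [K _ AK] := norm2_mulmx_bounded A.
by exists K => _ [v /= v1 <-]; rewrite (le_trans (AK v))// v1 mulr1.
Qed.

Lemma norm2_le_opnorm2 m n (A : 'M[R]_(m, n)) v :
  norm2 (A *m v) <= opnorm2 A * norm2 v.
Proof.
have [v0|v0] := eqVneq (norm2 v) 0.
  by rewrite v0 mulr0 (norm2_eq0 v0) mulmx0 -(scale0r (0 : 'cV_m)) norm2Z
     normr0 mul0r.
have v_gt0 : 0 < norm2 v by rewrite lt0r v0 norm2_ge0.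
rewrite -ler_pdivrMr// mulrC -[_^-1]ger0_norm ?invr_ge0 ?norm2_ge0//.
rewrite -norm2Z scalemxAr; apply: ub_le_sup; first exact: opnorm2_has_ubound.
by exists ((norm2 v)^-1 *: v) => //=; exact: norm2_normalize.
Qed.

(** * Rayleigh quotients and the largest eigenvalue *)

Lemma dot_mulmx_continuous n (M : 'M[R]_n) :
  continuous (fun v : 'rV[R]_n => dot v^T (M *m v^T)).
Proof.
have continuous_mul (f g : 'rV[R]_n -> R) :
    continuous f -> continuous g -> continuous (fun v => f v * g v).
  by move=> cf cg v; apply: continuousM; [exact: cf|exact: cg].
have continuous_sum (f : 'I_n -> 'rV[R]_n -> R) :
    (forall i, continuous (f i)) -> continuous (fun v => \sum_i f i v).
  by move=> cf; apply: continuous_big => //; exact: add_continuous.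
have continuous_tr i : continuous (fun v : 'rV[R]_n => v^T i 0).
  under eq_fun do rewrite mxE.
  exact: coord_continuous.
apply: (continuous_sum _) => i; apply: (continuous_mul _ _) => //.
under eq_fun do rewrite mxE.
apply: (continuous_sum _) => j.
by apply: (continuous_mul _ _) => //; apply: cst_continuous.
Qed.

(** A level set of a continuous quadratic form is closed, and this one lies in the compact cube
    [-1, 1]^n. Row vectors are the format of [rV_compact] and [EVT_max_rV]. *)
Lemma unit_sphere_compact n :
  compact [set v : 'rV[R]_n | dot v^T v^T = 1].
Proof.
have cube : compact [set v : 'rV[R]_n | forall i, v ord0 i \in `[-1, 1]].
  apply: (@rV_compact R n (fun=> `[-1 : R, 1]%classic)) => _.
  exact: segment_compact.
apply: subclosed_compact cube _.
  apply: (@preimage_closed _ _ (fun v : 'rV[R]_n => dot v^T v^T) [set 1]).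
    move=> v _; have := @dot_mulmx_continuous n 1%:M v.
    by congr (continuous_at _ _); apply/funext => w; rewrite mul1mx.
  exact: closed_eq.
move=> v /= v1 i; rewrite /= in_itv /= -ler_norml.
rewrite -(@expr_le1 _ 2)// real_normK ?num_real// -v1 /dot (bigD1 i)//= mxE -expr2.
by rewrite lerDl sumr_ge0// => j _; rewrite -expr2 sqr_ge0.
Qed.

(* A maximiser [y] of the Rayleigh quotient on the unit sphere is a zero of the
   nonnegative form [l |v|^2 - v^T M v], hence lies in its kernel. *)
Lemma rayleigh_max_eigenvector n (M : 'M[R]_n) : M^T = M -> (0 < n)%N ->
  exists l (y : 'cV[R]_n), [/\ dot y y = 1, M *m y = l *: y &
    forall v, dot v (M *m v) <= l * dot v v].
Proof.
move=> MT n_gt0.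
have sphere0 : [set v : 'rV[R]_n | dot v^T v^T = 1] !=set0.
  have [y /norm2_eq1 y1] := exists_unit_vector n_gt0.
  by exists y^T; rewrite /= trmxK.
have [c] := EVT_max_rV sphere0 (@unit_sphere_compact n)
  (continuous_subspaceT (@dot_mulmx_continuous n M)).
rewrite inE /= => c1 cmax; set y := c^T in c1.
set l := dot y (M *m y); exists l, y.
have lmax v : dot v (M *m v) <= l * dot v v.
  have [v0|v0] := eqVneq (norm2 v) 0.
    rewrite (norm2_eq0 v0) mulmx0 (_ : dot 0 0 = 0) ?mulr0//.
    by rewrite -sqr_norm2 -(scale0r (0 : 'cV_n)) norm2Z normr0 mul0r expr0n.
  have [u u1 ->] : exists2 u, dot u u = 1 & v = norm2 v *: u.
    exists ((norm2 v)^-1 *: v); first exact/norm2_eq1/norm2_normalize.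
    by rewrite scalerA divff// scale1r.
  have uMu : dot u (M *m u) <= l.
    by have := cmax u^T; rewrite inE /= trmxK; exact.
  rewrite -scalemxAr !(dotZl, dotZr) u1.
  by have := ler_wpM2l (sqr_ge0 (norm2 v)) uMu; lra.
split=> //; apply/esym/eqP; rewrite -subr_eq0; apply/eqP.
have [w wE] : exists w, w = l *: y - M *m y by eexists.
rewrite -wE; apply/dot_eq0.
have wMy : l * dot w y - dot w (M *m y) = dot w w.
  have <- : dot w (l *: y - M *m y) = dot w w by rewrite -wE.
  by rewrite dotDr dotZr -(scaleN1r (M *m y)) dotZr mulN1r.
have yMw : dot y (M *m w) = dot w (M *m y) by rewrite dot_mulr MT dotC.
have Mw := lmax w.
(* Put q(v) = l |v|^2 - v^T M v and d = |w|^2. Then q(y) = 0 and, by [wMy], the polar form of q at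
   (y, w) is d. At the test vector (q(w) + 1) y - d w the form equals - d^2 (q(w) + 2), so q >= 0
   forces d = 0. *)
have := lmax ((l * dot w w - dot w (M *m w) + 1) *: y + (- dot w w) *: w).
rewrite mulmxDr -!scalemxAr !(dotDl, dotDr, dotZl, dotZr) c1 yMw (dotC y w) -/l.
have := dot_ge0 w.
move: (dot w w) (dot w y) (dot w (M *m y)) (dot w (M *m w)) wMy Mw.
move=> d a b e ab ek d_ge0 h.
have : d ^+ 2 * (l * d - e + 2) <= 0 by rewrite -[X in X ^+ 2]ab in h *; nra.
move=> h'; apply/eqP; rewrite -sqrf_eq0 eq_le sqr_ge0 andbT.
by rewrite -(pmulr_lle0 _ (_ : 0 < l * d - e + 2))//; lra.
Qed.

(** The maximum [l] of the Rayleigh quotient is itself an eigenvalue, so it is at most the supremum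
    of the spectrum once the latter is known to be bounded. In size 0 the form vanishes and the
    value of [lambda_max] is irrelevant. *)
Lemma quadratic_form_le_lambda_max n (M : 'M[R]_n) (v : 'cV[R]_n) :
  M^T = M -> dot v (M *m v) <= lambda_max M * dot v v.
Proof.
case: n M v => [|n] M v MT; first by rewrite /dot !big_ord0 mulr0.
have [l [y [y1 My lmax]]] := rayleigh_max_eigenvector MT (ltn0Sn n).
apply: (le_trans (lmax v)); apply: ler_wpM2r; first exact: dot_ge0.
apply: ub_le_sup.
  (* Every eigenvalue is the Rayleigh quotient of its eigenvector, hence at most [l]. Since
     [eigenvalue] refers to row eigenvectors, symmetry of [M] is used to transpose. *)
  exists l => a /= /eigenvalueP[u uM u0].
  have {uM} : M *m u^T = a *: u^T.
    by apply: trmx_inj; rewrite trmx_mul linearZ /= !trmxK MT.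
  move=> Mu; have := lmax u^T; rewrite Mu dotZr ler_pM2r//.
  rewrite lt0r dot_ge0 andbT; apply: contra_neq u0 => /dot_eq0 u0.
  by apply: trmx_inj; rewrite u0 trmx0.
apply/eigenvalueP; exists y^T.
  by rewrite -[in LHS]MT -trmx_mul My linearZ.
apply: contra_eq_neq y1 => /(congr1 trmx); rewrite trmxK trmx0 => ->.
by rewrite /dot big1 ?(eq_sym 0) ?oner_neq0// => i _; rewrite mxE mul0r.
Qed.

(** * Matrix measures and projection along orthonormal rows *)

Lemma opnorm2_logarithmic_derivative_le n (A : 'M[R]_n) b : (0 < n)%N ->
  (forall y, norm2 y = 1 -> dot y (A *m y) <= b) ->
  lim ((opnorm2 (1%:M + h *: A) - 1) / h @[h --> 0^'+]) <= b.
Proof.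
move=> n_gt0 Ab; have [y0 y01] := exists_unit_vector n_gt0.
pose E := [set dot y (A *m y) | y in [set y | norm2 y = 1]].
have E0 : E !=set0 by exists (dot y0 (A *m y0)), y0.
have Eub : has_ubound E by exists b => _ [y /= y1 <-]; exact: Ab.
have supE_le : sup E <= b by apply: ge_sup => // _ [y /= y1 <-]; exact: Ab.
apply: le_trans supE_le.
have [K K_ge0 AK] := norm2_mulmx_bounded A.
(* An upper bound on the quotients alone would say nothing about [lim] if they diverged, so their
   convergence is proved by squeezing them between sup E and sup E + h K^2 / 2. *)
suff : (opnorm2 (1%:M + h *: A) - 1) / h @[h --> 0^'+] --> sup E.
  by move/cvg_lim => ->.
apply: (@squeeze_cvgr _ _ _ _ (cst (sup E))
  (fun h => sup E + h * (K ^+ 2 / 2))).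
- near=> h; have h_gt0 : 0 < h by near: h; exact: nbhs_right_gt.
  rewrite /cst ler_pdivlMr// ler_pdivrMr//; apply/andP; split.
    rewrite -ler_pdivlMr//; apply: ge_sup => // _ [y /= y1 <-].
    rewrite ler_pdivlMr// lerBrDl.
    have := norm2_le_opnorm2 (1%:M + h *: A) y; rewrite y1 mulr1.
    apply: le_trans; have := cauchy_schwarz y ((1%:M + h *: A) *m y).
    rewrite y1 mul1r; apply: le_trans.
    by rewrite mulmxDl mul1mx -scalemxAl dotDr dotZr (norm2_eq1 y1) mulrC.
  rewrite lerBlDl; apply: ge_sup.
    by exists (norm2 ((1%:M + h *: A) *m y0)), y0.
  move=> _ [y /= y1 <-].
  have yAy : dot y (A *m y) <= sup E by apply: ub_le_sup => //; exists y.
  have Ay2 : dot (A *m y) (A *m y) <= K ^+ 2.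
    rewrite -sqr_norm2 lerXn2r ?nnegrE ?norm2_ge0//.
    by rewrite (le_trans (AK y))// y1 mulr1.
  have := sqr_norm2 ((1%:M + h *: A) *m y).
  rewrite mulmxDl mul1mx -scalemxAl !(dotDl, dotDr, dotZl, dotZr) (norm2_eq1 y1).
  rewrite (dotC (A *m y) y).
  move: (norm2 _) (dot _ _) (dot _ _) yAy Ay2 => w k s sE kK w2.
  (* This removes the square root: w^2 = 1 + 2 h s + h^2 k then yields w <= 1 + h s + h^2 k / 2. *)
  have AMGM : 2 * w <= 1 + w ^+ 2.
    by have := sqr_ge0 (w - 1); lra.
  have : h * s <= h * sup E by rewrite ler_pM2l.
  have : h * (h * k) <= h * (h * K ^+ 2) by rewrite !ler_pM2l.
  lra.
- exact: cvg_cst.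
- apply: cvg_at_right_filter; rewrite -[X in _ --> X]addr0.
  apply: cvgD; first exact: cvg_cst.
  rewrite -[X in _ --> X](mul0r (K ^+ 2 / 2)).
  by apply: cvgM; [exact: cvg_id|exact: cvg_cst].
Unshelve. all: by end_near.
Qed.

(** W^T W is the orthogonal projection onto the complement of ker W: the residual z - W^T W z lies
    in ker W, and for z orthogonal to ker W it is orthogonal to itself. *)
Lemma perp_kerP p n (W : 'M[R]_(p, n)) (z : 'cV[R]_n) :
  W *m W^T = 1%:M -> perp_ker W z <-> z = W^T *m (W *m z).
Proof.
move=> WW; split=> [zperp|-> w Ww]; last first.
  by rewrite mulmxA -trmx_mul Ww trmx0 mul0mx.
set w := z - W^T *m (W *m z).
have Ww : W *m w = 0 by rewrite mulmxBr (mulmxA W W^T) WW mul1mx subrr.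
apply/eqP; rewrite -subr_eq0 -/w; apply/eqP/dot_eq0.
have wz : w^T *m w = 0.
  by rewrite {2}/w mulmxBr zperp// (mulmxA w^T) -trmx_mul Ww trmx0 mul0mx subrr.
by have /matrixP/(_ 0 0) := wz; rewrite dotE !mxE eqxx mulr1n.
Qed.

(** The map y -> W^T y carries the unit sphere onto the constraint set of [opseminorm], with inverse
    z -> W z, so both suprema are over the same set of values. *)
Lemma opseminorm_opnorm2 p n (W : 'M[R]_(p, n)) (A : 'M[R]_n) :
  W *m W^T = 1%:M -> opseminorm W A = opnorm2 (W *m A *m W^T).
Proof.
move=> WW; congr sup; apply/seteqP; split.
  move=> _ [z /= [/(perp_kerP _ WW) zE z1] <-]; exists (W *m z) => //.
  by rewrite /seminorm -!mulmxA -zE.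
move=> _ [z /= z1 <-]; exists (W^T *m z); last by rewrite /seminorm !mulmxA.
split; [apply/(perp_kerP _ WW)|rewrite /seminorm].
  by rewrite (mulmxA W) WW mul1mx.
by rewrite mulmxA WW mul1mx.
Qed.

Lemma mxmeasure_le p n (W : 'M[R]_(p, n)) (A : 'M[R]_n) b : (0 < p)%N ->
  W *m W^T = 1%:M ->
  (forall y, norm2 y = 1 -> dot y (sympart (W *m A *m W^T) *m y) <= b) ->
  mxmeasure W A <= b.
Proof.
move=> p_gt0 WW Ab; rewrite /mxmeasure.
have -> : (fun h => (opseminorm W (1%:M + h *: A) - 1) / h) =
          (fun h => (opnorm2 (1%:M + h *: (W *m A *m W^T)) - 1) / h).
  apply/funext => h; rewrite opseminorm_opnorm2//.
  by rewrite mulmxDr mulmxDl mulmx1 WW -scalemxAr -scalemxAl.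
apply: opnorm2_logarithmic_derivative_le => // y y1.
(* A matrix and its transpose have the same quadratic form, so passing to the symmetric part changes
   nothing. *)
apply: le_trans (Ab y y1); rewrite /sympart -scalemxAl mulmxDl dotZr dotDr.
by rewrite [X in _ + X]dot_mulr trmxK (dotC (_ *m y)); lra.
Qed.

Lemma trmx_sympart n (A : 'M[R]_n) : (sympart A)^T = sympart A.
Proof. by rewrite /sympart linearZ linearD /= trmxK addrC. Qed.

(** * Reduction of the block form to a 2 x 2 form *)

Lemma block_quadratic_form_le m n (S : 'M[R]_(m + n)) a b beta y : S^T = S ->
  lambda_max (ulsubmx S) <= - a -> lambda_max (drsubmx S) <= - b ->
  opnorm2 (ursubmx S) <= beta -> 0 <= beta ->
  norm2 y = 1 ->
  dot y (S *m y) <=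
    - (2^-1 * (a + b - Num.sqrt ((a - b) ^+ 2 + 4 * beta ^+ 2))).
Proof.
move=> ST Sa Sb Sbeta beta_ge0 /norm2_eq1.
rewrite -[y]vsubmxK; set u := usubmx y; set v := dsubmx y.
rewrite dot_col_mx -{1}[S]submxK mul_block_col dot_col_mx !dotDr.
have -> : dlsubmx S = (ursubmx S)^T by rewrite trmx_ursub ST.
rewrite (dot_mulr _ _ v) trmxK (dotC _ u).
have uu := quadratic_form_le_lambda_max u (etrans (trmx_ulsub S) (congr1 _ ST)).
have vv := quadratic_form_le_lambda_max v (etrans (trmx_drsub S) (congr1 _ ST)).
have uv : dot u (ursubmx S *m v) <= beta * (norm2 u * norm2 v).
  rewrite (le_trans (cauchy_schwarz _ _))// mulrCA ler_wpM2l ?norm2_ge0//.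
  by rewrite (le_trans (norm2_le_opnorm2 _ _))// ler_wpM2r ?norm2_ge0.
have {}uu := le_trans uu (ler_wpM2r (dot_ge0 u) Sa).
have {}vv := le_trans vv (ler_wpM2r (dot_ge0 v) Sb).
rewrite -!sqr_norm2 in uu vv *.
move: (norm2 u) (norm2 v) uu vv uv => s t uu vv uv st1.
have D_ge0 : 0 <= (a - b) ^+ 2 + 4 * beta ^+ 2.
  by rewrite addr_ge0 ?sqr_ge0// mulr_ge0 ?sqr_ge0.
have := sqr_sqrtr D_ge0; have := sqrtr_ge0 ((a - b) ^+ 2 + 4 * beta ^+ 2).
set r := Num.sqrt _ => r_ge0 r2.
(* With c = (a + b - r) / 2 these are p = a - c and q = b - c; as s^2 + t^2 = 1, the form in
   [form_ge0] is the slack left between - c and the bound on the blocks. *)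
pose p := (a - b + r) / 2; pose q := (r - (a - b)) / 2.
(* [[p, -beta], [-beta, q]] is singular with trace [r >= 0]. *)
have pq : p * q = beta ^+ 2 by rewrite /p /q; lra.
have form_ge0 : 0 <= p * s ^+ 2 - 2 * (beta * (s * t)) + q * t ^+ 2.
  (* If r = 0 then a = b and beta = 0, and the form vanishes. Otherwise multiplying by r = p + q
     makes it a sum of two squares. *)
  move: r_ge0; rewrite le0r => /orP[/eqP r0|r_gt0].
    have := sqr_ge0 (a - b); have := sqr_ge0 beta; move: r2.
    rewrite r0 expr0n /= => D0 beta2 ab2.
    have ab : a - b = 0 by apply/eqP; rewrite -sqrf_eq0; apply/eqP; lra.
    have beta0 : beta = 0 by apply/eqP; rewrite -sqrf_eq0; apply/eqP; lra.
    by rewrite /p /q ab r0 beta0; lra.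
  rewrite -(pmulr_rge0 _ r_gt0).
  have -> : r * (p * s ^+ 2 - 2 * (beta * (s * t)) + q * t ^+ 2) =
      (p * s - beta * t) ^+ 2 + (beta * s - q * t) ^+ 2.
    have -> : r = p + q by rewrite /p /q; lra.
    by ring: pq.
  by rewrite addr_ge0 ?sqr_ge0.
(* Homogenising the constants with s^2 + t^2 = 1 makes the goal linear in the monomials. *)
have : r * (s ^+ 2 + t ^+ 2) = r by rewrite st1 mulr1.
have : (a - b) * (s ^+ 2 + t ^+ 2) = a - b by rewrite st1 mulr1.
have : (a + b) * (s ^+ 2 + t ^+ 2) = a + b by rewrite st1 mulr1.
move: form_ge0; rewrite /p /q.
lra.
Qed.

Lemma Rproj_orthonormal N (Rtheta : 'M[R]_(N.-1, N)) :
  Rtheta *m Rtheta^T = 1%:M -> Rproj Rtheta *m (Rproj Rtheta)^T = 1%:M.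
Proof.
move=> RR; rewrite /Rproj tr_block_mx mulmx_block !trmx0 trmx1 RR.
by rewrite !mulmx0 !mul0mx mulmx1 !addr0 add0r scalar_mx_block.
Qed.

End Euclid.

Theorem theorem1 (R : realType) (N : nat) (N_ge2 : (2 <= N)%N)
    (mg : microgrid R N)
    (Rtheta : 'M[R]_(N.-1, N)) (hRtheta : orthonormal_basis_perp1 Rtheta)
    (Vlow Vupp gamma_max : R) (D : set 'rV[R]_(N + N))
    (hD : admissible_domain mg Vlow Vupp gamma_max D)
    (D_convex : convex_set D)
    (c_theta c_V beta : R)
    (c_theta_gt0 : 0 < c_theta) (c_V_gt0 : 0 < c_V) (beta_ge0 : 0 <= beta)
    (hblocks : forall (x : 'rV[R]_(N + N)) (t : R), D x -> 0 <= t ->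
       let S := Sproj Rtheta (Jac (field mg) t x) in
       [/\ lambda_max (ulsubmx S) <= - c_theta,
           lambda_max (drsubmx S) <= - c_V &
           opnorm2 (ursubmx S) <= beta])
    (hgap : beta ^+ 2 < c_theta * c_V) :
  let c := 2^-1 * (c_theta + c_V
             - Num.sqrt ((c_theta - c_V) ^+ 2 + 4 * beta ^+ 2)) in
  semi_contracting (Rproj Rtheta) (field mg) D c.
Proof.
split.
  (* Positivity of c: (c_theta + c_V)^2 - (c_theta - c_V)^2 = 4 c_theta c_V exceeds 4 beta^2. *)
  rewrite mulr_gt0 ?invr_gt0// subr_gt0 -[ltRHS]ger0_norm; last by lra.
  by rewrite -sqrtr_sqr ltr_sqrt ?exprn_gt0 ?addr_gt0//; lra.
move=> x t Dx t_ge0; have [Sul Sdr Sur] := hblocks x t Dx t_ge0.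
have N_gt0 : (0 < N.-1 + N)%N by rewrite addn_gt0 orbC (leq_trans _ N_ge2).
apply: (mxmeasure_le N_gt0 (Rproj_orthonormal hRtheta.1)) => y y1.
exact: block_quadratic_form_le (trmx_sympart _) Sul Sdr Sur beta_ge0 y1.
Qed.
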